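(* For every integer $k\ge 0$, the cumulative layer distribution $\bar\ell_k$ of the infinite random recursive tree is given by $$\bar\ell_k=\int_0^\infty s_k(y)\,e^{-y}\,dy,$$ where the functions $s_i:[0,\infty)\to\mathbb R$ are defined recursively by $$s_0(y)=1,\qquad s_i(y)=1-\exp\left[-\int_0^y s_{i-1}(y')\,dy'\right]\quad\text{for all } i\ge 1.$$
   Context: A random recursive tree (RRT) $G_n$ of size $n$ is a random labeled tree on the node set $\{1,\dots,n\}$ built as follows: start with node $1$; for $t=2,\dots,n$, node $t$ is attached by an edge to one node chosen uniformly at random from the existing nodes $\{1,\dots,t-1\}$, independently of previous choices. A leaf is a node of degree $1$ (the root, node $1$, is also a leaf if it has degree $1$). The layer of a node is the number of times all current leaves must be simultaneously stripped off (removed) from the tree for the node to become a leaf; leaves of the original tree are at layer $0$. If after some number of rounds the remaining tree consists of a single isolated node, that node counts as a leaf at that stage (so, e.g., the center of a star with at least 3 nodes is at layer $1$, and the single node of the one-node tree is at layer $0$). Let $L_{n,k}$ be the number of nodes at layer $k$ in $G_n$, let $\ell_k(n)=\mathbb E[L_{n,k}/n]$, and let $\ell_k=\lim_{n\to\infty}\ell_k(n)$ (these limits exist). The cumulative layer distribution of the infinite RRT is $\bar\ell_k=\sum_{k'=k}^\infty \ell_{k'}$. *)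

(* Defs.v *)
From HB Require Import structures.
From mathcomp Require Import all_boot all_order all_algebra.
From mathcomp Require Import all_classical all_reals all_analysis.

Set Implicit Arguments.
Unset Strict Implicit.
Unset Printing Implicit Defensive.

Import Order.TTheory GRing.Theory Num.Theory.
Import numFieldNormedType.Exports.

Local Open Scope ring_scope.

(* Layers, for a tree given by its (symmetric, irreflexive) adjacency
   relation [e]. A set [A] of nodes stands for the subgraph induced on [A]. *)
Section Layers.
Variables (T : finType) (e : rel T).
Implicit Type A : {set T}.

Definition degree_in A (v : T) : nat := #|[set u in A | e v u]|.

(* The second disjunct makes an isolated last node a leaf. *)
Definition leaves A : {set T} :=
  [set v in A | (degree_in A v == 1%N) || (A == [set v])].

Definition strip A : {set T} := A :\: leaves A.

(* Leaves are stripped at the next round and never come back, so a node [v]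
   belongs to [layer k] for at most one [k], which is the number of rounds
   needed for [v] to become a leaf. *)
Definition layer (k : nat) : {set T} := leaves (iter k strip [set: T]).

End Layers.

(* The nodes 1, ..., n are represented by 0, ..., n-1 : 'I_n. A function
   [p : {ffun 'I_n.-1 -> 'I_n.-1}] records the attachment choices: for
   t < n-1 the node t+1 is attached to the node p t, which has to be one of
   the t+1 nodes 0, ..., t already present. *)
Definition rrt_edge (n : nat) (p : {ffun 'I_n.-1 -> 'I_n.-1}) : rel 'I_n :=
  fun u v => [exists t : 'I_n.-1,
    ((u == t.+1 :> nat) && (v == p t :> nat)) ||
    ((v == t.+1 :> nat) && (u == p t :> nat))].

Section RandomRecursiveTree.
Variable R : realType.

Definition attach_prob (t j : nat) : R :=
  if (j <= t)%N then t.+1%:R^-1 else 0.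

(* Joint law of independent choices: the choices with some p t > t, which do
   not describe a recursive tree, have probability 0. *)
Definition rrt_prob (n : nat) (p : {ffun 'I_n.-1 -> 'I_n.-1}) : R :=
  \prod_(t < n.-1) attach_prob t (p t).

Definition rrt_expectation (n : nat)
    (X : {ffun 'I_n.-1 -> 'I_n.-1} -> R) : R :=
  \sum_(p : {ffun 'I_n.-1 -> 'I_n.-1}) rrt_prob p * X p.

Definition num_layer (n k : nat) (p : {ffun 'I_n.-1 -> 'I_n.-1}) : nat :=
  #|layer (rrt_edge p) k|.

(* ell_k(n); only meaningful for n > 0. *)
Definition layer_frac (k n : nat) : R :=
  rrt_expectation (fun p : {ffun 'I_n.-1 -> 'I_n.-1} =>
    (num_layer k p)%:R / n%:R).

Definition layer_dist (k : nat) : R := limn (layer_frac k).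

Definition cumulative_layer_dist (k : nat) : \bar R :=
  (\sum_(k <= j <oo) (layer_dist j)%:E)%E.

(* Only the values at y >= 0 are meaningful. *)
Fixpoint s_fun (i : nat) (y : R) : R :=
  if i is j.+1 then
    1 - expR (- \int[lebesgue_measure]_(x in `[0, y]%classic) s_fun j x)
  else 1.

End RandomRecursiveTree.

(* Main.v *)
Require Import Defs.
From HB Require Import structures.
From mathcomp Require Import all_boot all_order all_algebra.
From mathcomp Require Import ring lra zify.
From mathcomp Require Import all_classical all_reals all_analysis.
From mathcomp Require Import measurable_realfun.

(** The layer of a node is, up to a bounded number of exceptions per level, the
    height of the subtree formed by the node and its descendants. A node whose
    parent outlives all its children becomes a leaf exactly when its last child
    has been stripped. Stripping may also eat into the tree from the root, but
    at each round at most one remaining node loses its parent, and becomes the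
    new top, so that the nodes remaining after [k] rounds differ from the nodes of
    height at least [k] by fewer than [2 ^ k] nodes ([strip_sub_taller],
    [card_taller_strip]). This is negligible compared to [n], and it remains to
    find the limit law of the height.

    A node [v] has height at least [k.+1] if and only if some later node of
    height at least [k] chose [v] as its parent. Reveal the choices from the
    last node back to the first. When the node [t.+1] chooses uniformly among
    its [t.+1] predecessors, its own height is already determined, so [v] is
    hit at the predictable rate [J / t.+1], where [J] is the indicator that
    [t.+1] has height at least [k]. The indicator that [v] is never hit,
    multiplied by the exponential of the accumulated rate, is almost a
    martingale; hence, if the accumulated rate is close to a constant [S], then
    [v] has height at most [k] with probability close to [expR (- S)]
    ([unhit_approx]). The same estimate for the event that neither of two nodes
    is hit gives the asymptotic independence of heights, hence small
    covariances, hence by a second moment bound the concentration of the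
    accumulated rate at the next level. This closes an induction on [k]
    ([close_step]).

    The constants are found by measuring the position of [v] by its logarithmic
    age [y = ln (n / v)]. Steps of length about [1 / t] in [y] turn the
    accumulated rate into the integral of [s_k] from [0] to [y], so that
    [v] has height at least [k.+1] with probability close to
    [1 - exp (- \int_0^y s_k) = s_(k+1)(y)]. The logarithmic age of a uniformly
    chosen node is asymptotically exponential of mean [1], so the expected
    fraction of nodes of height at least [k] tends to the integral [b_k] of
    [s_k(y) exp(- y)] over [y >= 0] ([deep_frac_cvg]). Therefore the fraction
    of nodes at layer [k] tends to [b_k - b_(k+1)], and the tail sums telescope
    to [b_k] because [b_k] tends to [0] ([layer_tail_cvg0]): no mass escapes to
    high layers. *)

Set Implicit Arguments.
Unset Strict Implicit.
Unset Printing Implicit Defensive.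
Import Order.TTheory GRing.Theory Num.Theory.
Import numFieldNormedType.Exports.
Local Open Scope ring_scope.

(** * Stripping leaves of a rooted tree *)

(** A rooted tree is given by the map [pa] to the parent and by a rank that
    decreases towards the root. *)
Section RootedTree.
Variables (T : finType) (root : T) (pa : T -> T) (rk : T -> nat).
Hypothesis rk_pa : forall c, c != root -> (rk (pa c) < rk c)%N.
Variable e : rel T.
Hypothesis eE : forall u v,
  e u v = (u != root) && (pa u == v) || (v != root) && (pa v == u).
Implicit Types (A : {set T}) (k : nat).

(** The nodes having a descendant [k] generations below, that is, the nodes
    whose subtree has height at least [k]. *)
Fixpoint taller k : {set T} :=
  if k is k'.+1 then pa @: (taller k' :\ root) else [set: T].

(** For a nonempty [A] this says that [A] is connected and that [r] is its node
    closest to the root: climbing from any node of [A] stays in [A] and can only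
    stop at [r]. *)
Definition top_of A r := forall v, v \in A -> v != r -> (v != root) && (pa v \in A).

Lemma taller_mono k : taller k.+1 \subset taller k.
Proof.
elim: k => [|k IH]; first exact: finset.subsetT.
by apply: imsetS; apply: finset.setSD.
Qed.

Lemma edge_pa v : v != root -> e v (pa v).
Proof. by move=> vr; rewrite eE vr eqxx. Qed.

Lemma edge_sym u v : e u v = e v u.
Proof. by rewrite !eE orbC. Qed.

Lemma degree_in1P A v u w : degree_in e A v = 1%N ->
  u \in A -> e v u -> w \in A -> e v w -> u = w.
Proof.
move=> /eqP/cards1P[x nbrs] uA vu wA vw.
have : u \in [set u in A | e v u] by rewrite inE uA.
have : w \in [set u in A | e v u] by rewrite inE wA.
by rewrite nbrs !inE => /eqP-> /eqP->.
Qed.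

Lemma leaves_sub A : leaves e A \subset A.
Proof. by apply/fintype.subsetP => v; rewrite inE => /andP[]. Qed.

(** A leaf other than the top has its parent as only neighbour, hence no child in
    [A] that could lose its parent. Only the removal of the top itself matters:
    then its single neighbour takes its place. *)
Lemma top_of_strip A r : top_of A r -> exists r', top_of (strip e A) r'.
Proof.
move=> topA.
have [rl|rNl] := boolP (r \in leaves e A); last first.
  exists r => v; rewrite !inE => /andP[vNl vA] vr.
  have /andP[vroot pA] := topA v vA vr; rewrite vroot pA andbT /=.
  apply/negP => /orP[/eqP deg1|/eqP Apv]; last first.
    move: vA vroot; rewrite Apv inE => /eqP vpv vroot.
    by have := rk_pa vroot; rewrite -vpv ltnn.
  have [pr|/(topA _ pA)/andP[pvroot ppA]] := eqVneq (pa v) r.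
    by move: rNl; rewrite inE -pr pA deg1 eqxx.
  have vpp : v = pa (pa v).
    apply: (degree_in1P deg1) => //; last exact: edge_pa.
    by rewrite edge_sym edge_pa.
  have := ltn_trans (rk_pa pvroot) (rk_pa vroot).
  by rewrite -vpp ltnn.
move: (rl); rewrite inE => /andP[rA /orP[/eqP deg1|/eqP Ar]]; last first.
  by exists r => v /finset.setDP[+ _]; rewrite Ar inE => ->.
have /cards1P[r' nbrs] : degree_in e A r == 1%N by rewrite deg1.
exists r' => v; rewrite !inE => /andP[vNl vA] vr'.
have vr : v != r by apply: contraNneq vNl => ->; rewrite rA deg1 eqxx.
have /andP[vroot pA] := topA v vA vr; rewrite vroot pA andbT /=.
apply/negP => /orP[/eqP deg1'|/eqP Apv]; last first.
  by move: rA vA vr; rewrite Apv !inE => /eqP-> ->.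
have [pr|/(topA _ pA)/andP[pvroot ppA]] := eqVneq (pa v) r.
  have : v \in [set u in A | e r u] by rewrite inE vA edge_sym -pr edge_pa.
  by rewrite nbrs inE (negPf vr').
have vpp : v = pa (pa v).
  apply: (degree_in1P deg1') => //; last exact: edge_pa.
  by rewrite edge_sym edge_pa.
have := ltn_trans (rk_pa pvroot) (rk_pa vroot).
by rewrite -vpp ltnn.
Qed.

Lemma top_of_iter_strip k : exists r, top_of (iter k (strip e) [set: T]) r.
Proof.
elim: k => [|k [r IH]] /=; last exact: top_of_strip IH.
by exists root => v _ vr; rewrite vr inE.
Qed.

(** A connected set with at least two nodes has no isolated node. For the top
    itself, a node of least rank among the others must be one of its children. *)
Lemma degree_gt0 A r v : top_of A r -> v \in A -> A != [set v] ->
  (0 < degree_in e A v)%N.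
Proof.
move=> topA vA Av; rewrite card_gt0; apply/set0Pn.
have [vr|/(topA _ vA)/andP[vroot pA]] := eqVneq v r; last first.
  by exists (pa v); rewrite inE pA edge_pa.
have /set0Pn[w0 w0A] : A :\ r != finset.set0.
  rewrite -vr; apply: contra Av => /eqP A0.
  by rewrite -(finset.setD1K vA) A0 finset.setU0.
case: (@arg_minnP _ w0 [in A :\ r] rk) => //= w /finset.setD1P[wr wA] wmin.
have /andP[wroot pA] := topA _ wA wr.
exists w; rewrite inE wA edge_sym /= eE wroot /=.
have [->|pwr] := eqVneq (pa w) r; first by rewrite vr eqxx.
have := wmin (pa w); rewrite !inE pwr pA leqNgt rk_pa //.
by move=> /(_ isT).
Qed.

(** A node that survives a round has two neighbours left, one of which has to be
    a child. *)
Lemma strip_sub_taller k : iter k (strip e) [set: T] \subset taller k.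
Proof.
elim: k => [|k IH]; first by rewrite /= fintype.subxx.
have [r topA] := top_of_iter_strip k.
apply/fintype.subsetP => v; rewrite iterS.
set A := iter k _ _ in IH topA *.
rewrite /strip !inE => /andP[vNl vA].
move: vNl; rewrite vA /= negb_or => /andP[deg1 Av].
have [u1 [u2 [/setIdP[u1A vu1] /setIdP[u2A vu2] u12]]] :
    exists u1 u2, [/\ u1 \in [set u in A | e v u],
      u2 \in [set u in A | e v u] & u1 != u2].
  apply/card_gt1P; move: (degree_gt0 topA vA Av) deg1.
  by rewrite /degree_in; case: #|_| => [|[]].
wlog : u1 u2 u1A vu1 u2A vu2 u12 / (u1 != root) && (pa u1 == v).
  move=> W; have [h|h] := boolP ((u1 != root) && (pa u1 == v)).
    exact: (W u1 u2).
  apply: (W u2 u1) => //; first by rewrite eq_sym.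
  move: vu1 vu2; rewrite !eE (negPf h) orbF => /andP[vr /eqP pu1].
  by rewrite pu1 (negPf u12) andbF.
move=> /andP[u1r /eqP <-]; apply: imset_f.
by rewrite !inE u1r (fintype.subsetP IH).
Qed.

(** Call a node lost after [k] rounds if its height is at least [k] but it has
    been stripped. A node lost after [k.+1] rounds is lost after [k] rounds, or is
    the parent of a node lost after [k] rounds, or is the top of what remains
    after [k] rounds: any other one still has both its parent and a child and is
    not a leaf. So the number of lost nodes at most doubles, plus one. *)
Lemma card_taller_strip k :
  (#|taller k :\: iter k (strip e) [set: T]| < 2 ^ k)%N.
Proof.
elim: k => [|k IH]; first by rewrite /= finset.setDv cards0.
have [r topA] := top_of_iter_strip k.
rewrite iterS; set A := iter k _ _ in IH topA *.
set D := taller k :\: A in IH.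
have : taller k.+1 :\: strip e A \subset r |: (D :|: pa @: D).
  apply/fintype.subsetP => v /finset.setDP[vB vNs].
  have vBk := fintype.subsetP (taller_mono k) _ vB.
  rewrite !inE; have [//|vr /=] := eqVneq v r.
  have [vA|vNA] := boolP (v \in A); last by rewrite vBk.
  move: vB => /imsetP[c /finset.setD1P[croot cB] vc].
  have [cA|cNA] := boolP (c \in A); last first.
    by rewrite orbC vc imset_f // !inE cNA.
  exfalso; move: vNs; rewrite !inE vA /= andbT negbK.
  have vNc : c != v.
    by apply: contraTneq (rk_pa croot) => cv; rewrite -vc -cv ltnn.
  have evc : e v c by rewrite vc edge_sym edge_pa.
  case/orP => [/eqP deg1|/eqP Av]; last first.
    by move: cA; rewrite Av inE (negPf vNc).
  have /andP[vroot pA] := topA _ vA vr.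
  have pvc := degree_in1P deg1 pA (edge_pa vroot) cA evc.
  move: (rk_pa croot); rewrite -vc => /(ltn_trans (rk_pa vroot)).
  by rewrite pvc ltnn.
move=> /subset_leq_card /leq_ltn_trans; apply.
have := leq_imset_card pa D.
have := leq_card_setU D (pa @: D).
have := cardsU1 r (D :|: pa @: D).
move: IH; rewrite expnS mul2n -addnn; case: (r \notin _) => /=.
all: set a := #|_|; set b := #|_|; set c := #|_|; set d := #|_|.
all: move=> IH E1 h1 h2.
all: rewrite E1 ?add1n ?add0n.
- rewrite -[X in (X < _)%N]addn1.
  apply: (@leq_trans (a + a).+2); first by rewrite addn1 !ltnS (leq_trans h1) // leq_add2l.
  by rewrite -addSn -addnS leq_add.
- apply: (@leq_trans (a + a).+2); first by rewrite ltnS (leq_trans h1) // leqW // leq_add2l.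
  by rewrite -addSn -addnS leq_add.
Qed.

End RootedTree.

(** * Expectations of independent choices *)

(** The choices are independent, the choice at [i] having law [w i]. *)
Section ProductExpectation.
Variables (R : realType) (I J : finType) (w : I -> J -> R).
Hypothesis w_ge0 : forall i j, 0 <= w i j.
Hypothesis w_sum1 : forall i, \sum_j w i j = 1.
Implicit Types (X Y : {ffun I -> J} -> R) (p : {ffun I -> J}).

Definition prod_expect X := \sum_(p : {ffun I -> J}) (\prod_i w i (p i)) * X p.
Local Notation E := prod_expect.

Definition resample p (i : I) (j : J) : {ffun I -> J} :=
  [ffun i' => if i' == i then j else p i'].

Lemma prod_expect_cst c : E (fun=> c) = c.
Proof.
rewrite /E -mulr_suml -(bigA_distr_bigA w).
by rewrite big1 ?mul1r // => i _.
Qed.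

Lemma prod_expectD X Y : E (fun p => X p + Y p) = E X + E Y.
Proof. by rewrite /E -big_split; apply: eq_bigr => p _; rewrite mulrDr. Qed.

Lemma prod_expectZ c X : E (fun p => c * X p) = c * E X.
Proof. by rewrite /E mulr_sumr; apply: eq_bigr => p _; rewrite mulrCA. Qed.

Lemma prod_expectB X Y : E (fun p => X p - Y p) = E X - E Y.
Proof.
rewrite -[X in _ - X]mul1r -mulNr -prod_expectZ -prod_expectD.
by apply: eq_bigr => p _; rewrite mulN1r.
Qed.

Lemma prod_expect_sum (K : Type) (s : seq K) (P : pred K)
    (F : K -> {ffun I -> J} -> R) :
  E (fun p => \sum_(k <- s | P k) F k p) = \sum_(k <- s | P k) E (F k).
Proof. by rewrite /E exchange_big; apply: eq_bigr => p _; rewrite mulr_sumr. Qed.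

(** Choices of weight zero do not count, so the comparison is needed only on the
    support of the law. *)
Lemma le_prod_expect X Y :
  (forall p, (forall i, 0 < w i (p i)) -> X p <= Y p) -> E X <= E Y.
Proof.
move=> XY; apply: ler_sum => p _.
have [wp|] := boolP [forall i, 0 < w i (p i)].
  by rewrite ler_wpM2l ?prodr_ge0 // XY // => i; apply/forallP: i.
rewrite negb_forall => /existsP[i wi]; rewrite (bigD1 i) //=.
have -> : w i (p i) = 0 by apply/eqP; move: wi; rewrite lt0r w_ge0 andbT negbK.
by rewrite !mul0r.
Qed.

Lemma ler_norm_prod_expect X : `|E X| <= E (fun p => `|X p|).
Proof.
apply: (le_trans (ler_norm_sum _ _ _)); apply: ler_sum => p _.
by rewrite normrM ger0_norm // prodr_ge0.
Qed.

(** Drawing the choice at [i] afresh does not change the joint law. This replaces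
    conditioning on all the other choices. *)
Lemma prod_expect_resample i X :
  E X = E (fun p => \sum_j w i j * X (resample p i j)).
Proof.
transitivity (\sum_(p : {ffun I -> J}) \sum_j (\prod_i w i (p i)) * (w i j * X p)).
  apply: eq_bigr => p _; rewrite -mulr_sumr -mulr_suml w_sum1 mul1r //.
transitivity (\sum_(p : {ffun I -> J}) \sum_j (\prod_i w i (p i)) * (w i j * X (resample p i j)));
  last by apply: eq_bigr => p _; rewrite mulr_sumr.
rewrite !pair_big /=.
(* Exchanging the old and the new value at [i] is an involution that preserves
   the weight. *)
pose h (pj : {ffun I -> J} * J) := (resample pj.1 i pj.2, pj.1 i).
have hK : involutive h.
  move=> [p j]; rewrite /h /=; congr pair; last by rewrite ffunE eqxx.
  by apply/ffunP => i'; rewrite !ffunE; case: eqP => [->|].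
rewrite (reindex_inj (inv_inj hK)) /=; apply: eq_bigr => -[p j] _ /=.
rewrite !mulrA; congr (_ * _).
rewrite (bigD1 i) //= [in RHS](bigD1 i) //= ffunE eqxx.
rewrite mulrAC [w i j * _]mulrC mulrAC; congr (_ * _ * _).
by apply: eq_bigr => i' /negPf ne; rewrite ffunE ne.
Qed.

(** The inequality of Cauchy and Schwarz, obtained by integrating the pointwise
    bound of [|x|] by [x^2 / (2 c) + c / 2] for [c = sqrt V]. *)
Lemma prod_expect_le_sqrt X (V : R) : 0 < V ->
  E (fun p => X p ^+ 2) <= V -> E (fun p => `|X p|) <= Num.sqrt V.
Proof.
move=> V0 EX2; set c := Num.sqrt V.
have c0 : 0 < c by rewrite sqrtr_gt0.
apply: (@le_trans _ _ (E (fun p => (2 * c)^-1 * X p ^+ 2 + c / 2))).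
  apply: le_prod_expect => p _; rewrite -subr_ge0.
  have -> : (2 * c)^-1 * X p ^+ 2 + c / 2 - `|X p| =
      (2 * c)^-1 * (`|X p| - c) ^+ 2.
    by rewrite -(real_normK (num_real (X p))); field; rewrite gt_eqF.
  by rewrite mulr_ge0 ?sqr_ge0 // invr_ge0 mulr_ge0 // ltW.
rewrite prod_expectD prod_expectZ prod_expect_cst.
apply: (@le_trans _ _ ((2 * c)^-1 * V + c / 2)).
  by rewrite lerD2r ler_wpM2l // invr_ge0 mulr_ge0 // ltW.
have -> : V = c ^+ 2 by rewrite sqr_sqrtr // ltW.
rewrite le_eqVlt; apply/orP; left; apply/eqP.
by field; rewrite gt_eqF.
Qed.

End ProductExpectation.

(** * Avoiding a set at predictable times *)

Section ExpBounds.
Variable R : realType.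
Implicit Types x d K : R.

Lemma onem_mul_expR_le1 x : (1 - x) * expR x <= 1.
Proof.
rewrite -(ler_pM2r (expR_gt0 (- x))) -mulrA -expRD subrr expR0 mulr1 mul1r.
exact: expR_ge1Dx.
Qed.

Lemma onem_sqr_le_expR x : x <= 1 -> 1 - x ^+ 2 <= (1 - x) * expR x.
Proof.
move=> x1; apply: (@le_trans _ _ ((1 - x) * (1 + x))); first by lra.
by rewrite ler_wpM2l ?subr_ge0 // expR_ge1Dx.
Qed.

(** The exponential is Lipschitz with constant [expR K] on the interval from [- K]
    to [K]. *)
Lemma norm_onem_expR_le d K : `|d| <= K -> `|1 - expR d| <= `|d| * expR K.
Proof.
move=> dK; have K0 : 1 <= expR K.
  by rewrite -expR0 ler_expR (le_trans _ dK).
have [d0|d0] := leP 0 d.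
  have e1 : 1 <= expR d by rewrite -expR0 ler_expR.
  rewrite ler0_norm ?subr_le0 // ger0_norm //.
  rewrite ger0_norm // in dK.
  apply: (@le_trans _ _ (d * expR d)); last by rewrite ler_wpM2l // ler_expR.
  have := onem_mul_expR_le1 d; lra.
have e1 : expR d <= 1 by rewrite -expR0 ler_expR ltW.
rewrite ger0_norm ?subr_ge0 // ltr0_norm //.
apply: (@le_trans _ _ (- d)); first by have := expR_ge1Dx d; lra.
by rewrite ler_peMr // oppr_ge0 ltW.
Qed.

End ExpBounds.

(** Choices are revealed from the last index to the first. The event [c t] is
    predictable: it depends only on the choices made at indices beyond [t]. A hit
    occurs at [t] when [c t] holds and the choice at [t] falls in [B]. *)
Section HittingMartingale.
Variables (R : realType) (N : nat) (J : finType) (w : 'I_N -> J -> R).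
Hypothesis w_ge0 : forall i j, 0 <= w i j.
Hypothesis w_sum1 : forall i, \sum_j w i j = 1.
Local Notation E := (prod_expect w).

Variables (c : 'I_N -> {ffun 'I_N -> J} -> bool) (B : pred J).
Hypothesis c_predictable : forall (t s : 'I_N) p j, (s <= t)%N ->
  c t (resample p s j) = c t p.

Definition hit_rate t : R := \sum_j w t j * (B j)%:R.
Local Notation a := hit_rate.

(** The indicator that no hit occurs. *)
Definition unhit p : R := \prod_t (1 - (c t p && B (p t))%:R).
Definition compensator p : R := \sum_t (c t p)%:R * a t.

Lemma hit_rate_ge0 t : 0 <= a t.
Proof. by apply: sumr_ge0 => j _; rewrite mulr_ge0. Qed.

Lemma hit_rate_le1 t : a t <= 1.
Proof.
rewrite -(w_sum1 t); apply: ler_sum => j _.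
by rewrite ler_piMr // lern1 leq_b1.
Qed.

(** The near-martingale once the choices at the indices [t >= m] are revealed. *)
Let M (m : nat) p : R := \prod_(t < N | (m <= t)%N)
  ((1 - (c t p && B (p t))%:R) * expR ((c t p)%:R * a t)).

Let M_ge0 m p : 0 <= M m p.
Proof.
apply: prodr_ge0 => t _; apply: mulr_ge0; last exact: expR_ge0.
by rewrite subr_ge0 lern1 leq_b1.
Qed.

Let M_step (m : 'I_N) :
  E (M m) = E (fun p => (1 - (c m p)%:R * a m) * expR ((c m p)%:R * a m) * M m.+1 p).
Proof.
rewrite (prod_expect_resample w_sum1 m).
apply: eq_bigr => p _; congr (_ * _).
have Mp j : M m (resample p m j) =
    (1 - (c m p && B j)%:R) * expR ((c m p)%:R * a m) * M m.+1 p.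
  rewrite /M (bigD1 m) //= c_predictable // ffunE eqxx; congr (_ * _).
  apply: eq_big => [t|t /andP[mt tm]].
    by rewrite ltn_neqAle andbC eq_sym.
  by rewrite c_predictable // ffunE (negPf tm).
under eq_bigr do rewrite Mp !mulrA; rewrite -!mulr_suml; congr (_ * _ * _).
case: (c m p) => /=; last first.
  by rewrite mulr0n mul0r subr0; under eq_bigr do rewrite mulr1.
rewrite mulr1n mul1r /a -[X in X - _](w_sum1 m) -sumrB; apply: eq_bigr => j _.
by rewrite mulrBr mulr1.
Qed.

(** Each factor has conditional expectation [(1 - x) * expR x] with [x] equal to
    [a t] or [0], which lies between [1 - a t ^+ 2] and [1]. *)
Let M_bounds d : (d <= N)%N ->
  1 - \sum_(t < N | (N - d <= t)%N) a t ^+ 2 <= E (M (N - d)) <= 1.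
Proof.
elim: d => [_|d IH dN].
  have none (t : 'I_N) : (N - 0 <= t)%N = false.
    by rewrite subn0 leqNgt ltn_ord.
  rewrite big_pred0 // subr0.
  have -> : E (M (N - 0)) = E (fun=> 1).
    by apply: eq_bigr => p _; congr (_ * _); rewrite /M big_pred0.
  by rewrite prod_expect_cst // lexx.
have mN : (N - d.+1 < N)%N by rewrite ltn_subrL (leq_ltn_trans _ dN).
pose m := Ordinal mN.
have mS : (m.+1 = N - d)%N by rewrite /= subnSK.
have /andP[lo hi] := IH (ltnW dN).
rewrite -[(N - d.+1)%N]/(m : nat) M_step mS.
rewrite (bigD1 m) //=.
have -> : \sum_(i < N | (N - d.+1 <= i)%N && (i != m)) a i ^+ 2 =
    \sum_(t < N | (N - d <= t)%N) a t ^+ 2.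
  by apply: eq_bigl => t; rewrite -mS ltn_neqAle andbC eq_sym.
set s := \sum_(_ | _) _ in lo *.
have am0 := hit_rate_ge0 m; have am1 := hit_rate_le1 m.
have s0 : 0 <= s by apply: sumr_ge0 => t _; apply: sqr_ge0.
have cr p : ((c m p)%:R * a m : R) <= 1 /\
    1 - a m ^+ 2 <= 1 - ((c m p)%:R * a m) ^+ 2.
  case: (c m p); rewrite /= ?mul1r ?mul0r //.
  by rewrite ler01 expr0n /= subr0 lerBlDr lerDl sqr_ge0.
apply/andP; split; last first.
  apply: le_trans hi; apply: le_prod_expect => // p _.
  by rewrite ler_piMl // onem_mul_expR_le1.
apply: (@le_trans _ _ (E (fun p => (1 - a m ^+ 2) * M (N - d) p))).
  rewrite prod_expectZ.
  have am2 : a m ^+ 2 <= 1 by rewrite expr_le1.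
  apply: (@le_trans _ _ ((1 - a m ^+ 2) * (1 - s))).
    have : 0 <= a m ^+ 2 * s by rewrite mulr_ge0 ?sqr_ge0.
    lra.
  by rewrite ler_wpM2l // subr_ge0.
apply: le_prod_expect => // p _; rewrite ler_wpM2r //.
have [c1 c2] := cr p; apply: (le_trans c2); exact: onem_sqr_le_expR.
Qed.

Lemma unhit_martingale :
  1 - \sum_t a t ^+ 2 <= E (fun p => unhit p * expR (compensator p)) <= 1.
Proof.
have := M_bounds (leqnn N); rewrite subnn.
have -> : E (M 0) = E (fun p => unhit p * expR (compensator p)).
  by apply: eq_bigr => p _; rewrite /M big_split /= -expR_sum.
by [].
Qed.

(** If the compensator is close to the constant [S] in mean, then the probability
    of no hit is close to [expR (- S)]: multiply the indicator by [expR S] instead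
    of the exponential of the compensator, whose effect is known from
    [unhit_martingale]. *)
Lemma unhit_approx (S K : R) : 0 <= S <= K -> \sum_t a t <= K ->
  `|E unhit - expR (- S)| <=
    expR K * E (fun p => `|compensator p - S|) + \sum_t a t ^+ 2.
Proof.
move=> /andP[S0 SK] aK.
have /andP[lo hi] := unhit_martingale.
set F := E _ in lo hi; set d := \sum_t a t ^+ 2 in lo *.
have -> : E unhit - expR (- S) =
    E (fun p => unhit p * (1 - expR (compensator p - S))) + expR (- S) * (F - 1).
  rewrite mulrBr mulr1 addrA; congr (_ - _).
  rewrite /F -prod_expectZ -prod_expectD; apply: eq_bigr => p _.
  by rewrite expRD; congr (_ * _); ring.
have unhit01 p : 0 <= unhit p <= 1.
  have f01 t : 0 <= (1 - (c t p && B (p t))%:R : R) <= 1.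
    by rewrite subr_ge0 lern1 leq_b1 lerBlDr lerDl ler0n.
  rewrite prodr_ge0 => [|t _]; last by case/andP: (f01 t).
  exact: prodr_ile1.
apply: (le_trans (ler_normD _ _)); apply: lerD; last first.
  have e1 : expR (- S) <= 1 by rewrite -expR0 ler_expR oppr_le0.
  rewrite normrM ger0_norm ?expR_ge0 //.
  apply: (@le_trans _ _ (1 * `|F - 1|)); first by rewrite ler_wpM2r.
  by rewrite mul1r ler_norml; apply/andP; split; lra.
apply: (le_trans (ler_norm_prod_expect w_ge0 _)).
rewrite -prod_expectZ; apply: le_prod_expect => // p _.
have /andP[u0 u1] := unhit01 p.
rewrite normrM ger0_norm // mulrC [expR K * _]mulrC.
have C0 : 0 <= compensator p.
  by apply: sumr_ge0 => t _; rewrite mulr_ge0 ?ler0n ?hit_rate_ge0.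
have CK : compensator p <= K.
  apply: le_trans aK; apply: ler_sum => t _.
  by rewrite ler_piMl ?hit_rate_ge0 // lern1 leq_b1.
apply: (@le_trans _ _ (`|1 - expR (compensator p - S)|)).
  by rewrite ler_piMr.
by apply: norm_onem_expR_le; rewrite ler_norml; apply/andP; split; lra.
Qed.

End HittingMartingale.

(** * The functions s_k and their integrals *)

Section MonotoneIntegrals.
Variable R : realType.
Local Notation mu := (@lebesgue_measure R).
Implicit Types (f g G : R -> R) (a b x y : R).

Lemma is_derive_Rintegral g G a b : continuous g ->
  (forall x, is_derive x 1 G (g x)) -> a <= b ->
  \int[mu]_(x in `[a, b]) g x = G b - G a.
Proof.
move=> cg dG; rewrite le_eqVlt => /predU1P[->|ab].
  by rewrite set_itv1 Rintegral_set1 subrr.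
have cG x : {for x, continuous G}.
  by apply/differentiable_continuous/derivable1_diffP; have [] := dG x.
rewrite /Rintegral (@continuous_FTC2 _ g G a b ab) //.
- by apply: continuous_subspaceT => x; exact: cg.
- split; first by move=> x _; have [] := dG x.
  + by apply: cvg_at_right_filter; exact: cG.
  + by apply: cvg_at_left_filter; exact: cG.
- by move=> x _; rewrite derive1E; have [_ ->] := dG x.
Qed.

Lemma continuous_itv_integrable g a b : continuous g ->
  mu.-integrable `[a, b] (EFin \o g).
Proof.
move=> cg; apply: continuous_compact_integrable; first exact: segment_compact.
by apply: continuous_subspaceT => x; exact: cg.
Qed.

Lemma monotone_mul_integrable f g a b : nondecreasing_fun f ->
  (forall x, 0 <= f x <= 1) -> continuous g ->
  mu.-integrable `[a, b] (EFin \o (fun x => f x * g x)).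
Proof.
move=> fnd f01 cg.
apply: (le_integrable _ _ _ (continuous_itv_integrable a b cg)) => //=.
  apply/measurable_EFinP; apply: measurable_funM.
    exact: nondecreasing_measurable.
  by apply: measurable_funTS; exact: continuous_measurable_fun.
move=> x _; rewrite lee_fin normrM ler_piMl //.
by have /andP[f0 f1] := f01 x; rewrite ger0_norm.
Qed.

(** With [g] constant this bounds the increments of the integral of [s_k], and
    with [g] the exponential density it bounds those of the weighted integral.
    Monotonicity of the [s_k] is all the regularity that the Riemann sums below
    need. *)
Lemma monotone_mul_integral_bounds f g G a b : nondecreasing_fun f ->
  (forall x, 0 <= f x <= 1) -> continuous g -> (forall x, 0 <= g x) ->
  (forall x, is_derive x 1 G (g x)) -> 0 <= a -> a <= b ->
  f a * (G b - G a) <=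
    \int[mu]_(x in `[0, b]) (f x * g x) - \int[mu]_(x in `[0, a]) (f x * g x)
    <= f b * (G b - G a).
Proof.
move=> fnd f01 cg g0 dG a0 ab.
rewrite Rintegral_itvB ?bnd_simp //; last exact: monotone_mul_integrable.
have iab : mu.-integrable `[a, b] (EFin \o (fun x => f x * g x)).
  exact: monotone_mul_integrable.
rewrite Rintegral_itv_obnd_cbnd; last first.
  by apply: integrableS iab => //; apply: subset_itvr; rewrite bnd_simp.
have icst c : mu.-integrable `[a, b] (EFin \o (fun x => c * g x)).
  by apply: continuous_itv_integrable => x; apply: cvgM; [exact: cvg_cst|exact: cg].
have intc c : \int[mu]_(x in `[a, b]) (c * g x) = c * (G b - G a).
  by rewrite RintegralZl ?(is_derive_Rintegral cg dG) //; exact: continuous_itv_integrable.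
rewrite -!intc; apply/andP; split; apply: le_Rintegral => // x /=;
  rewrite in_itv /= => /andP[ax xb]; rewrite ler_wpM2r // fnd //.
Qed.

End MonotoneIntegrals.

Section SFun.
Variable R : realType.
Local Notation mu := (@lebesgue_measure R).
Local Notation s := (@s_fun R).
Implicit Types (x y a b : R) (k : nat).

Definition s_int k y : R := \int[mu]_(x in `[0, y]) s k x.

Lemma s_funS k y : s k.+1 y = 1 - expR (- s_int k y).
Proof. by []. Qed.

Lemma s_int_neg k y : y <= 0 -> s_int k y = 0.
Proof.
rewrite /s_int le_eqVlt => /predU1P[->|y0].
  by rewrite set_itv1 Rintegral_set1.
by rewrite set_itv_ge ?Rintegral_set0 // bnd_simp -ltNge.
Qed.

Lemma s_int_bounds_of k a b : nondecreasing_fun (s k) ->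
  (forall x, 0 <= s k x <= 1) -> 0 <= a -> a <= b ->
  s k a * (b - a) <= s_int k b - s_int k a <= s k b * (b - a).
Proof.
move=> nd s01 a0 ab.
have c1 : continuous (fun _ : R => 1 : R) by move=> x; exact: cvg_cst.
have := @monotone_mul_integral_bounds _ _ (fun=> 1) id a b nd s01
  c1 (fun=> ler01) (fun x => is_derive_id x 1) a0 ab.
have mul1 y : \int[mu]_(x in `[0, y]) (s k x * 1) = s_int k y.
  by apply: eq_Rintegral => x _; rewrite mulr1.
by rewrite !mul1.
Qed.

(** Both properties are proved at once, on the whole line: for [y <= 0] the domain
    of integration is negligible, so that [s_k] vanishes there for [k > 0]. *)
Lemma s_fun_mono01 k : nondecreasing_fun (s k) /\ forall x, 0 <= s k x <= 1.
Proof.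
elim: k => [|k [nd s01]].
  by split => [x y _ //|x]; rewrite ?lexx ?ler01.
have Ind : nondecreasing_fun (s_int k).
  move=> x y xy; have [x0|/ltW x0] := leP 0 x.
    have /andP[+ _] := s_int_bounds_of nd s01 x0 xy.
    rewrite -(subr_ge0 (s_int k x)); apply: le_trans.
    by rewrite mulr_ge0 ?subr_ge0 //; case/andP: (s01 x).
  rewrite (s_int_neg _ x0); apply: Rintegral_ge0 => z _.
  by case/andP: (s01 z).
split=> [x y xy|x].
  by rewrite !s_funS lerB // ler_expR lerN2; exact: Ind.
have I0 : 0 <= s_int k x.
  by apply: Rintegral_ge0 => z _; case/andP: (s01 z).
by rewrite s_funS subr_ge0 expR_le1 oppr_le0 I0 lerBlDr lerDl expR_ge0.
Qed.

Lemma s_fun_nd k : nondecreasing_fun (s k).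
Proof. by have [] := s_fun_mono01 k. Qed.

Lemma s_fun01 k x : 0 <= s k x <= 1.
Proof. by have [_ ->] := s_fun_mono01 k. Qed.

Lemma s_int_bounds k a b : 0 <= a -> a <= b ->
  s k a * (b - a) <= s_int k b - s_int k a <= s k b * (b - a).
Proof. exact: (s_int_bounds_of (@s_fun_nd k) (s_fun01 k)). Qed.

Lemma s_int_ge0 k y : 0 <= s_int k y.
Proof. by apply: Rintegral_ge0 => z _; case/andP: (s_fun01 k z). Qed.

Lemma s_int_le k y : 0 <= y -> s_int k y <= y.
Proof.
move=> y0; have /andP[_] := s_int_bounds k (lexx 0) y0.
rewrite (s_int_neg k (lexx 0)) !subr0 => /le_trans; apply.
by rewrite ler_piMl //; case/andP: (s_fun01 k y).
Qed.

Definition s_wint k y : R := \int[mu]_(x in `[0, y]) (s k x * expR (- x)).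

Let continuous_expRZ (c : R) : continuous (fun x => expR (c * x)).
Proof.
move=> x; apply: continuous_comp; last exact: continuous_expR.
by apply: cvgM; [exact: cvg_cst|exact: cvg_id].
Qed.

Let cN : continuous (fun x : R => expR (- x)).
Proof.
by move=> x; apply: continuous_comp; [exact: opp_continuous|exact: continuous_expR].
Qed.

Let dN (x : R) : is_derive x 1 (fun x : R => - expR (- x)) (expR (- x)).
Proof. by apply: is_derive_eq; rewrite mulrN1 opprK. Qed.

Lemma s_wint_bounds k a b : 0 <= a -> a <= b ->
  s k a * (expR (- a) - expR (- b)) <= s_wint k b - s_wint k a
    <= s k b * (expR (- a) - expR (- b)).
Proof.
move=> a0 ab.
have := monotone_mul_integral_bounds (@s_fun_nd k) (s_fun01 k) cN
  (fun x => expR_ge0 (- x)) dN a0 ab.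
by rewrite opprK [- expR (- b) + _]addrC.
Qed.

Lemma s_wint0 k : s_wint k 0 = 0.
Proof. by rewrite /s_wint set_itv1 Rintegral_set1. Qed.

(** Iterating the integral divides [expR (c * y)] by [c] at each step. *)
Lemma s_fun_le_expR (c : R) k y : 0 < c -> 0 <= y ->
  s k y <= (c ^+ k)^-1 * expR (c * y).
Proof.
move=> c0; elim: k y => [|k IH] y y0.
  by rewrite /= expr0 invr1 mul1r -expR0 ler_expR mulr_ge0 // ltW.
rewrite s_funS; apply: (@le_trans _ _ (s_int k y)).
  by have := expR_ge1Dx (- s_int k y); lra.
have cc : continuous (fun x => (c ^+ k)^-1 * expR (c * x)).
  by move=> x; apply: cvgM; [exact: cvg_cst|exact: continuous_expRZ].
apply: (@le_trans _ _ (\int[mu]_(x in `[0, y]) ((c ^+ k)^-1 * expR (c * x)))).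
  apply: le_Rintegral => //.
  - have c1 : continuous (fun _ : R => 1 : R) by move=> x; exact: cvg_cst.
    have := @monotone_mul_integrable _ _ _ 0 y (@s_fun_nd k) (s_fun01 k) c1.
    by apply: eq_integrable => // x _; rewrite /= mulr1.
  - exact: continuous_itv_integrable.
  - by move=> x /=; rewrite in_itv /= => /andP[x0 _]; exact: IH.
have dG (x : R) : is_derive x 1 (fun x => (c ^+ k.+1)^-1 * expR (c * x))
    ((c ^+ k)^-1 * expR (c * x)).
  apply: is_derive_eq; rewrite /GRing.scale /= exprS invfM; field.
  by rewrite expf_neq0 ?gt_eqF.
rewrite (is_derive_Rintegral cc dG) //.
by rewrite lerBlDr lerDl mulr_ge0 ?expR_ge0 // invr_ge0 exprn_ge0 // ltW.
Qed.

(** The claimed value of the cumulative layer distribution. *)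
Definition layer_tail k : \bar R :=
  (\int[mu]_(y in `[0%R, +oo[) (s k y * expR (- y))%:E)%E.

Lemma layer_tail_bounds k y : 0 <= y ->
  ((s_wint k y)%:E <= layer_tail k <= (s_wint k y + expR (- y))%:E)%E.
Proof.
move=> y0.
have mse : measurable_fun setT (fun x => s k x * expR (- x)).
  apply: measurable_funM; first exact: (nondecreasing_measurable _ (@s_fun_nd k)).
  exact: continuous_measurable_fun.
have se0 x : (0 <= (s k x * expR (- x))%:E)%E.
  by rewrite lee_fin mulr_ge0 ?expR_ge0 //; case/andP: (s_fun01 k x).
have wE : (s_wint k y)%:E = (\int[mu]_(x in `[0%R, y]) (s k x * expR (- x))%:E)%E.
  rewrite /s_wint /Rintegral fineK //; apply: integrable_fin_num => //.
  exact: (monotone_mul_integrable _ _ (@s_fun_nd k) (s_fun01 k)).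
have tailE : (\int[mu]_(x in `[y, +oo[) (expR (- x))%:E = (expR (- y))%:E)%E.
  have := @ge0_continuous_FTC2y _ (fun x => expR (- x)) (fun x : R => - expR (- x)) y 0.
  rewrite EFinN oppeK add0e; apply => //.
  - by apply: continuous_subspaceT => x; exact: cN.
  - by rewrite -oppr0; apply: cvgN; exact: cvgr_expR.
  - by apply: cvgN; apply: cvg_at_right_filter; exact: cN.
  - by move=> x _; rewrite derive1E; have [_ ->] := dN x.
have -> : layer_tail k = ((s_wint k y)%:E +
    \int[mu]_(x in `]y, +oo[) (s k x * expR (- x))%:E)%E.
  rewrite wE /layer_tail (@itv_bndbnd_setU _ _ _ (BRight y)) ?bnd_simp //.
  rewrite ge0_integral_setU //=.
  - by apply/measurable_EFinP; exact: measurable_funTS.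
  - apply/disj_setPS => x [/=]; rewrite 2!in_itv/= => /andP[_ xy].
    by rewrite ltNge xy.
rewrite EFinD -tailE.
apply/andP; split; first by rewrite leeDl //; apply: integral_ge0.
rewrite leeD2l // -integral_itv_obnd_cbnd; last first.
  by apply/measurable_EFinP; apply: measurable_funTS; exact: continuous_measurable_fun.
apply: ge0_le_integral => //.
- by apply/measurable_EFinP; exact: measurable_funTS.
- by apply/measurable_EFinP; apply: measurable_funTS; exact: continuous_measurable_fun.
- move=> x _; rewrite lee_fin ler_piMl ?expR_ge0 //.
  by case/andP: (s_fun01 k x).
Qed.

Lemma layer_tail_fin_num k : layer_tail k \is a fin_num.
Proof.
have /andP[lo hi] := layer_tail_bounds k (lexx 0).
by rewrite fin_numElt (lt_le_trans _ lo) ?ltNyr // (le_lt_trans hi) // ltry.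
Qed.

Lemma layer_tail_cvg0 : ((fine (layer_tail n)) @[n --> \oo] --> (0 : R))%classic.
Proof.
(* Cutting the integral at [k / c], the bound [c^-k * expR (c * y)] becomes
   [(e / c) ^ k = 2 ^- k]. *)
pose c : R := 2 * expR 1; have c0 : 0 < c by rewrite mulr_gt0 ?expR_gt0.
pose u k : R := 2^-1 ^+ k + expR (- c^-1) ^+ k.
have u0 : (u n @[n --> \oo] --> (0 : R))%classic.
  rewrite -[0](addr0 0); apply: cvgD; apply: cvg_expr.
    by rewrite ger0_norm ?invf_lt1 ?ltr1n.
  by rewrite ger0_norm ?expR_ge0 // expR_lt1 oppr_lt0 invr_gt0.
apply: (squeeze_cvgr _ (cvg_cst 0) u0); apply: nearW => k.
have y0 : 0 <= k%:R / c by rewrite divr_ge0 // ltW.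
have /andP[lo _] := layer_tail_bounds k (lexx 0).
have /andP[_ hi] := layer_tail_bounds k y0.
move: lo hi; rewrite -{1 2}(fineK (layer_tail_fin_num k)) !lee_fin s_wint0.
move=> -> /le_trans; apply.
rewrite /u -expRM_natl mulrN lerD2r.
have /andP[_] := s_wint_bounds k (lexx 0) y0.
rewrite s_wint0 subr0 oppr0 expR0 => /le_trans; apply.
have /andP[s0 _] := s_fun01 k (k%:R / c).
apply: (@le_trans _ _ (s k (k%:R / c))).
  by rewrite ler_piMr // lerBlDr lerDl expR_ge0.
apply: (le_trans (s_fun_le_expR k c0 y0)).
rewrite mulrCA divff ?gt_eqF // mulr1 -[k%:R]mulr1 expRM_natl /c exprMn invfM.
by rewrite exprVn -mulrA mulVf ?mulr1 // expf_neq0 // gt_eqF ?expR_gt0.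
Qed.

End SFun.

(** * Riemann sums on the logarithmic grid *)

(** Comparison of a sum with the increments of a function, in the form used for
    Riemann sums of monotone functions. *)
Lemma telescope_bounds (R : realType) (F g : nat -> R) m n : (m <= n)%N ->
  (forall r, (m <= r < n)%N -> g r.+1 <= F r - F r.+1 <= g r) ->
  \sum_(m <= r < n) g r.+1 <= F m - F n <= \sum_(m <= r < n) g r.
Proof.
move=> mn Fg.
have -> : F m - F n = \sum_(m <= r < n) (F r - F r.+1).
  rewrite -opprB -(telescope_sumr _ mn) -sumrN.
  by apply: eq_bigr => r _; rewrite opprB.
by apply/andP; split; apply: ler_sum_nat => r /Fg/andP[].
Qed.

Section LogGrid.
Variables (R : realType) (n : nat).
Implicit Types (k r v m : nat).

(** The logarithmic age of node [r] in a tree with [n] nodes. *)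
Definition log_age r : R := ln (n%:R / r%:R).

Lemma expRN_log_age r : (0 < r <= n)%N -> expR (- log_age r) = r%:R / n%:R.
Proof.
case/andP=> r0 rn; have n0 := leq_trans r0 rn.
rewrite expRN lnK; first by rewrite invf_div.
by rewrite posrE divr_gt0 ?ltr0n.
Qed.

Lemma log_age_ge0 r : (0 < r <= n)%N -> 0 <= log_age r.
Proof.
by case/andP=> r0 rn; rewrite ln_ge0 // ler_pdivlMr ?ltr0n // mul1r ler_nat.
Qed.

Lemma log_age_n : (0 < n)%N -> log_age n = 0.
Proof. by move=> n0; rewrite /log_age divff ?ln1 // pnatr_eq0 -lt0n. Qed.

Lemma log_age_diff r : (0 < r < n)%N ->
  r.+1%:R^-1 <= log_age r - log_age r.+1 <= r%:R^-1.
Proof.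
case/andP=> r0 rn; have n0 := ltn_trans r0 rn.
have pr (i : nat) : (0 < i)%N -> (i%:R : R) \is Num.pos by rewrite posrE ltr0n.
rewrite /log_age !ln_div ?pr //.
have -> : ln n%:R - ln r%:R - (ln n%:R - ln r.+1%:R) = ln r.+1%:R - ln r%:R :> R by ring.
have r0' : r%:R != 0 :> R by rewrite pnatr_eq0 -lt0n.
have r1' : r.+1%:R != 0 :> R by rewrite pnatr_eq0.
apply/andP; split.
  have lt1 : r.+1%:R^-1 < 1 :> R by rewrite invf_lt1 ?ltr1n ?ltr0n.
  have := @le_ln1Dx R (- r.+1%:R^-1); rewrite ltrN2 lt1 => /(_ isT).
  have -> : 1 - r.+1%:R^-1 = r%:R / r.+1%:R :> R by field.
  rewrite ln_div ?pr //; set x := _^-1 => h. lra.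
have := @le_ln1Dx R (r%:R^-1); rewrite (lt_trans (ltrN10 R)) ?invr_gt0 ?ltr0n //.
have -> : 1 + r%:R^-1 = r.+1%:R / r%:R :> R by field.
by rewrite ln_div ?pr // => /(_ isT).
Qed.

Lemma log_age_anti r : (0 < r < n)%N -> log_age r.+1 <= log_age r.
Proof.
move=> /log_age_diff/andP[d0 _]; rewrite -subr_ge0; apply: le_trans d0.
by rewrite invr_ge0 ler0n.
Qed.

(** The step of the logarithmic grid at [r] lies between [1 / r.+1] and [1 / r],
    so that the integral of the monotone [s_k] lies between two Riemann sums that
    differ only in their end terms. *)
Lemma s_int_grid k v : (0 < v < n)%N ->
  `| \sum_(v <= t < n.-1) s_fun k (log_age t.+1) / t.+1%:R
     - s_int k (log_age v) | <= v%:R^-1.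
Proof.
move=> /andP[v0 vn]; pose g r : R := s_fun k (log_age r) / r%:R.
have n0 := ltn_trans v0 vn.
have g0 r : 0 <= g r by rewrite divr_ge0 ?ler0n //; case/andP: (s_fun01 k (log_age r)).
have /andP[lo hi] : \sum_(v <= r < n) g r.+1 <= s_int k (log_age v) - s_int k (log_age n)
    <= \sum_(v <= r < n) g r.
  apply: (@telescope_bounds _ (fun r => s_int k (log_age r)) g _ _ (ltnW vn)) => r /andP[vr rn].
  have r0 : (0 < r < n)%N by rewrite (leq_trans v0).
  have /andP[d1 d2] := log_age_diff r0.
  have /andP[b1 b2] := @s_int_bounds R k _ _ (log_age_ge0 (rn : (0 < r.+1 <= n)%N))
    (log_age_anti r0).
  rewrite (le_trans _ b1) ?(le_trans b2) //.
    by rewrite ler_wpM2l //; case/andP: (s_fun01 k (log_age r)).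
  by rewrite ler_wpM2l //; case/andP: (s_fun01 k (log_age r.+1)).
move: lo hi; rewrite log_age_n // (s_int_neg k (lexx 0)) subr0.
have vn' : (v <= n.-1)%N by rewrite -ltnS prednK.
rewrite -{1 2}(prednK n0) big_nat_recr //= [X in _ -> _ <= X -> _]big_nat_recl //.
rewrite -/(g _); set S := \sum_(v <= _ < _) _ => lo hi.
have gn := g0 n.-1.+1.
have gv : g v <= v%:R^-1.
  by rewrite /g ler_piMl ?invr_ge0 ?ler0n //; case/andP: (s_fun01 k (log_age v)).
by rewrite ler_norml; apply/andP; split; lra.
Qed.

(** The exponential law gives mass [1 / n] to each cell of the logarithmic grid. *)
Lemma s_wint_grid k m : (0 < m <= n)%N ->
  `| (\sum_(m <= r < n) s_fun k (log_age r)) / n%:R - s_wint k (log_age m) |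
    <= n%:R^-1.
Proof.
move=> /andP[m0 mn]; pose g r : R := s_fun k (log_age r) / n%:R.
have n0 := leq_trans m0 mn.
have g0 r : 0 <= g r by rewrite divr_ge0 ?ler0n //; case/andP: (s_fun01 k (log_age r)).
have g1 r : g r <= n%:R^-1.
  by rewrite /g ler_piMl ?invr_ge0 ?ler0n //; case/andP: (s_fun01 k (log_age r)).
have /andP[lo hi] : \sum_(m <= r < n) g r.+1 <= s_wint k (log_age m) - s_wint k (log_age n)
    <= \sum_(m <= r < n) g r.
  apply: (@telescope_bounds _ (fun r => s_wint k (log_age r)) g _ _ mn) => r /andP[mr rn].
  have r0 : (0 < r < n)%N by rewrite (leq_trans m0).
  have := @s_wint_bounds R k _ _ (log_age_ge0 (rn : (0 < r.+1 <= n)%N))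
    (log_age_anti r0).
  have rle : (0 < r <= n)%N by case/andP: r0 => -> /ltnW.
  rewrite !expRN_log_age //.
  have -> : r.+1%:R / n%:R - r%:R / n%:R = n%:R^-1 :> R.
    by rewrite -mulrBl -natrB // subSnn mul1r.
  by [].
move: lo hi; rewrite log_age_n // s_wint0 subr0 mulr_suml -/(g _).
have := telescope_sumr g mn; rewrite sumrB.
set S1 := \sum_(m <= _ < _) _; set S := \sum_(m <= _ < _) _ => E lo hi.
have gn := g0 n; have gm := g1 m.
by rewrite ler_norml; apply/andP; split; lra.
Qed.

End LogGrid.

(** * Heights of subtrees when the choices are revealed backwards *)

Section Deep.
Variables (R : realType) (N : nat).
Implicit Types (p : {ffun 'I_N -> 'I_N}) (k u v : nat).
Local Notation n := N.+1.

(** The condition [v <= t], which holds in every recursive tree, is included so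
    that [deep k p v] depends only on the choices at indices [t >= v]. *)
Fixpoint deep k p v : bool :=
  if k is k'.+1
  then [exists t : 'I_N, [&& (v <= t)%N, p t == v :> nat & deep k' p t.+1]]
  else true.

Lemma deep_resample k p (s j : 'I_N) v : (s < v)%N ->
  deep k (resample p s j) v = deep k p v.
Proof.
elim: k v => //= k IH v sv; apply: eq_existsb => t.
have [vt|//] := leqP v t; rewrite ffunE.
have st := leq_trans sv vt.
have /negPf-> : t != s by rewrite -val_eqE /= gtn_eqF.
by rewrite IH // ltnW.
Qed.

(** The index [t] stands for the choice of the node [t.+1]. *)
Definition attach (t j : 'I_N) : R := attach_prob R t j.
Local Notation E := (prod_expect attach).

Lemma attach_ge0 t j : 0 <= attach t j.
Proof. by rewrite /attach /attach_prob; case: ifP. Qed.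

Lemma hit_rate1 t v :
  hit_rate attach (fun j => j == v :> nat) t = (v <= t)%:R / t.+1%:R.
Proof.
rewrite /hit_rate; have [vt|tv] := leqP v t.
  pose j := Ordinal (leq_ltn_trans vt (ltn_ord t)).
  rewrite (bigD1 j) //= eqxx big1 ?addr0; first by rewrite /attach /attach_prob vt mulr1 mul1r.
  move=> i ij; suff /negPf-> : (i != v :> nat) by rewrite mulr0.
  by apply: contraNneq ij => iv; apply/eqP/val_inj.
rewrite mul0r big1 // => i _; case: eqP => [iv|]; last by rewrite mulr0.
by rewrite /attach /attach_prob iv leqNgt tv mul0r.
Qed.

Lemma attach_sum1 t : \sum_j attach t j = 1.
Proof.
have -> : \sum_j attach t j = \sum_(v < t.+1) hit_rate attach (fun j => j == v :> nat) t.
  rewrite /hit_rate exchange_big; apply: eq_bigr => j _ /=.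
  rewrite -mulr_sumr; have [jt|tj] := leqP j t; last first.
    by rewrite /attach /attach_prob leqNgt tj mul0r.
  rewrite (bigD1 (Ordinal (jt : (j < t.+1)%N))) //= eqxx big1 ?addr0 ?mulr1 // => i ij.
  case: eqP => // ji; case/eqP: ij; exact/val_inj.
under eq_bigr => v _ do rewrite hit_rate1 -ltnS ltn_ord mul1r.
by rewrite sumr_const card_ord -[_ *+ _]mulr_natl divff // pnatr_eq0.
Qed.

Lemma eq_rrt_expect (X Y : {ffun 'I_N -> 'I_N} -> R) :
  (forall p, (forall t, (p t <= t)%N) -> X p = Y p) -> E X = E Y.
Proof.
move=> XY; have val p : (forall t, 0 < attach t (p t)) -> forall t, (p t <= t)%N.
  by move=> ap t; have := ap t; rewrite /attach /attach_prob; case: ifP; rewrite ?ltxx.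
by apply/eqP; rewrite eq_le; apply/andP; split;
  apply: (le_prod_expect attach_ge0) => p /val/XY->.
Qed.

Definition deepR k v p : R := (deep k p v)%:R.

Lemma deepR01 k v p : 0 <= deepR k v p <= 1.
Proof. by rewrite ler0n lern1 leq_b1. Qed.

Let c k (t : 'I_N) p := deep k p t.+1.

Let c_pred k (t s : 'I_N) p j : (s <= t)%N -> c k t (resample p s j) = c k t p.
Proof. by move=> st; rewrite /c deep_resample. Qed.

Lemma prodr_onem_bool (I : finType) (b : pred I) :
  \prod_i (1 - (b i)%:R) = 1 - [exists i, b i]%:R :> R.
Proof.
have [/existsP[i bi]|/existsPn nb] := boolP [exists i, b i].
  by rewrite (bigD1 i) //= bi subrr mul0r.
by rewrite subr0 big1 // => i _; rewrite (negPf (nb i)) subr0.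
Qed.

Let unhit_deep k v p : (forall t, (p t <= t)%N) ->
  unhit R (c k) (fun j => j == v :> nat) p = 1 - deepR k.+1 v p.
Proof.
move=> pv; rewrite /unhit prodr_onem_bool; congr (1 - _%:R); congr nat_of_bool.
apply: eq_existsb => t; rewrite andbC; case: eqP => [<-|]; last by rewrite andbF.
by rewrite pv.
Qed.

Let unhit_deep2 k u v p : (forall t, (p t <= t)%N) ->
  unhit R (c k) (fun j => (j == u :> nat) || (j == v :> nat)) p =
  (1 - deepR k.+1 u p) * (1 - deepR k.+1 v p).
Proof.
move=> pv; rewrite -!unhit_deep // /unhit !prodr_onem_bool.
have -> : [exists i, c k i p && ((p i == u :> nat) || (p i == v :> nat))] =
    [exists i, c k i p && (p i == u :> nat)] || [exists i, c k i p && (p i == v :> nat)].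
  apply/existsP/orP => [[i /andP[ci /orP[pu|pw]]]|[/existsP[i /andP[ci pu]]|/existsP[i /andP[ci pw]]]].
  - by left; apply/existsP; exists i; rewrite ci.
  - by right; apply/existsP; exists i; rewrite ci.
  - by exists i; rewrite ci pu.
  - by exists i; rewrite ci pw orbT.
by do 2 case: [exists _, _] => /=; rewrite ?subrr ?mul0r ?mulr0 ?subr0 ?mulr1.
Qed.

(** The rate at which [v] is hit by nodes of height at least [k], accumulated over
    all the later nodes. *)
Definition exposure k v p : R := \sum_(v <= t < N) deepR k t.+1 p / t.+1%:R.

Lemma sum_ord_from v (F : nat -> R) :
  \sum_(t < N) (v <= t)%:R * F t = \sum_(v <= t < N) F t.
Proof.
rewrite (big_nat_widenl v 0) // big_mkord [RHS]big_mkcond /=.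
by apply: eq_bigr => t _; case: leqP; rewrite ?mul1r ?mul0r.
Qed.

Let compensator1 k v p :
  compensator attach (c k) (fun j => j == v :> nat) p = exposure k v p.
Proof.
rewrite /exposure -(sum_ord_from v (fun t => deepR k t.+1 p / t.+1%:R)).
by apply: eq_bigr => t _; rewrite hit_rate1 mulrCA.
Qed.

Let hit_rate2 t u v : u != v ->
  hit_rate attach (fun j => (j == u :> nat) || (j == v :> nat)) t =
  (u <= t)%:R / t.+1%:R + (v <= t)%:R / t.+1%:R.
Proof.
move=> uv; rewrite -!hit_rate1 /hit_rate -big_split; apply: eq_bigr => j _ /=.
rewrite -mulrDr; congr (_ * _); case: eqP => [->|_]; last by rewrite add0r.
by rewrite (negPf uv) addr0.
Qed.

Let compensator2 k u v p : u != v ->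
  compensator attach (c k) (fun j => (j == u :> nat) || (j == v :> nat)) p =
  exposure k u p + exposure k v p.
Proof.
move=> uv; rewrite -!compensator1 /compensator -big_split; apply: eq_bigr => t _.
by rewrite hit_rate2 // -!hit_rate1 mulrDr.
Qed.

Local Notation sh k v := (s_fun k (log_age R n v)).

Definition single_close k (err : R) v := `|E (deepR k v) - sh k v| <= err.
Definition pair_close k (err : R) u v :=
  `|E (fun p => (1 - deepR k u p) * (1 - deepR k v p)) -
    (1 - sh k u) * (1 - sh k v)| <= err.

Variable q : nat.
(** The nodes [v >= n / q], whose logarithmic age is at most [ln q]. The error
    bounds are uniform over these, and the remaining fraction [1 / q] of the
    nodes is neglected at the end. *)
Definition mature v := (n <= q * v)%N && (v <= N)%N.
(** The induction hypothesis on heights: marginals are close to [s_k] and pairs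
    are close to being independent. *)
Definition law_close k (err : R) := (forall v, mature v -> single_close k err v) /\
  (forall u v, mature u -> mature v -> u != v -> pair_close k err u v).

Lemma mature_gt0 v : mature v -> (0 < v)%N.
Proof. by case: v => //; rewrite /mature muln0. Qed.

Lemma mature_inv v : mature v -> v%:R^-1 <= q%:R / n%:R :> R.
Proof.
move=> mv; have v0 := mature_gt0 mv; case/andP: mv => nqv _.
rewrite ler_pdivlMr ?ltr0n // mulrC ler_pdivrMr ?ltr0n //.
by rewrite -natrM ler_nat.
Qed.

Lemma mature_le u v : mature u -> (u <= v <= N)%N -> mature v.
Proof.
move=> /andP[nqu _] /andP[uv vN]; rewrite /mature vN andbT (leq_trans nqu) //.
by rewrite leq_mul2l uv orbT.
Qed.

Lemma covariance_le k (err : R) : 0 <= err -> law_close k err ->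
  forall u v, mature u -> mature v -> u != v ->
  `|E (fun p => (deepR k u p - sh k u) * (deepR k v p - sh k v))| <= 3 * err.
Proof.
move=> err0 [sc pc] u v mu mv uv.
have := sc u mu; have := sc v mv; have := pc u v mu mv uv.
rewrite /single_close /pair_close.
have /andP[u0 u1] := s_fun01 k (log_age R n u).
have /andP[v0 v1] := s_fun01 k (log_age R n v).
set su := s_fun k _ in u0 u1 *; set sv := s_fun k _ in v0 v1 *.
set Eu := E (deepR k u); set Ev := E (deepR k v).
set P := E _ => hp hv hu.
have -> : E (fun p => (deepR k u p - su) * (deepR k v p - sv)) =
    (P - (1 - su) * (1 - sv)) + (1 - su) * (Ev - sv) + (1 - sv) * (Eu - su).
  pose X p := (1 - deepR k u p) * (1 - deepR k v p).
  have -> : E (fun p => (deepR k u p - su) * (deepR k v p - sv)) =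
      E (fun p => X p + ((1 - su) * deepR k v p + ((1 - sv) * deepR k u p + (su * sv - 1)))).
    by apply: eq_bigr => p _; congr (_ * _); rewrite /X; ring.
  rewrite prod_expectD -/P prod_expectD prod_expectZ prod_expectD prod_expectZ.
  rewrite (prod_expect_cst attach_sum1) -/Eu -/Ev; ring.
have le1 (x e : R) : 0 <= 1 - x <= 1 -> `|e| <= err -> `|(1 - x) * e| <= err.
  move=> /andP[x0 x1] he; rewrite normrM ger0_norm //.
  by apply: le_trans he; rewrite ler_piMl.
have := le1 su (Ev - sv); rewrite subr_ge0 u1 lerBlDr lerDl u0 => /(_ isT hv) h1.
have := le1 sv (Eu - su); rewrite subr_ge0 v1 lerBlDr lerDl v0 => /(_ isT hu) h2.
have := ler_normD (P - (1 - su) * (1 - sv) + (1 - su) * (Ev - sv)) ((1 - sv) * (Eu - su)).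
have := ler_normD (P - (1 - su) * (1 - sv)) ((1 - su) * (Ev - sv)).
lra.
Qed.


Lemma ler_sum_pred (I : finType) (P : pred I) (F G : I -> R) :
  (forall i, P i -> F i <= G i) -> (forall i, 0 <= G i) ->
  \sum_(i | P i) F i <= \sum_i G i.
Proof.
move=> FG G0; rewrite big_mkcond; apply: ler_sum => i _.
by case: ifP => // /FG.
Qed.

(** The diagonal terms contribute at most [N * (q / n) ^ 2] and the others are
    covariances. *)
Lemma exposure_second_moment k (err : R) v : 0 <= err -> law_close k err -> mature v ->
  E (fun p => (exposure k v p - \sum_(v <= t < N) sh k t.+1 / t.+1%:R) ^+ 2)
    <= q%:R ^+ 2 * (3 * err + n%:R^-1).
Proof.
move=> err0 ce mv.
pose X (t : 'I_N) p := (deepR k t.+1 p - sh k t.+1) / t.+1%:R.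
have mt (t : 'I_N) : (v <= t)%N -> mature t.+1.
  by move=> vt; apply: (mature_le mv); rewrite ltn_ord (leq_trans vt).
have exE p : exposure k v p - \sum_(v <= t < N) sh k t.+1 / t.+1%:R =
    \sum_(t < N | (v <= t)%N) X t p.
  rewrite /exposure -sumrB (big_nat_widenl v 0) // big_mkord.
  by apply: eq_bigr => t _; rewrite /X mulrBl.
have -> : E (fun p => (exposure k v p - \sum_(v <= t < N) sh k t.+1 / t.+1%:R) ^+ 2) =
    \sum_(s < N | (v <= s)%N) \sum_(t < N | (v <= t)%N) E (fun p => X s p * X t p).
  under [RHS]eq_bigr do rewrite -prod_expect_sum.
  rewrite -prod_expect_sum; apply: eq_bigr => p _; congr (_ * _).
  by rewrite exE expr2 big_distrlr.
pose r : R := q%:R / n%:R; have r0 : 0 <= r by rewrite divr_ge0.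
have XX (s t : 'I_N) : (v <= s)%N -> (v <= t)%N ->
    E (fun p => X s p * X t p) <= r ^+ 2 * (3 * err + (s == t)%:R).
  move=> vs vt; apply: (le_trans (ler_norm _)).
  have -> : E (fun p => X s p * X t p) = (s.+1%:R^-1 * t.+1%:R^-1) *
      E (fun p => (deepR k s.+1 p - sh k s.+1) * (deepR k t.+1 p - sh k t.+1)).
    rewrite -prod_expectZ; apply: eq_bigr => p _; congr (_ * _).
    by rewrite /X mulrACA mulrC.
  rewrite normrM ger0_norm ?mulr_ge0 ?invr_ge0 ?ler0n //.
  rewrite expr2; apply: ler_pM; rewrite ?mulr_ge0 ?invr_ge0 ?ler0n //.
    by apply: ler_pM; rewrite ?invr_ge0 ?ler0n // mature_inv // mt.
  have [->|st] := eqVneq s t; last first.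
    by rewrite addr0; apply: covariance_le => //; exact: mt.
  apply: (@le_trans _ _ 1); last by rewrite lerDr mulr_ge0.
  apply: (le_trans (ler_norm_prod_expect attach_ge0 _)).
  rewrite -[leRHS](prod_expect_cst attach_sum1).
  apply: (le_prod_expect attach_ge0) => p _.
  have /andP[d0 d1] := deepR01 k t.+1 p.
  have /andP[s0 s1] := s_fun01 k (log_age R n t.+1).
  rewrite normrM mulr_ile1 // ler_norml; apply/andP; split; lra.
apply: (@le_trans _ _ (\sum_(s < N) r ^+ 2 * (N%:R * (3 * err) + 1))).
  apply: ler_sum_pred => [s vs|s]; last first.
    by rewrite mulr_ge0 ?sqr_ge0 // addr_ge0 // !mulr_ge0.
  apply: (@le_trans _ _ (\sum_(t < N) r ^+ 2 * (3 * err + (s == t)%:R))).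
    apply: ler_sum_pred => [t vt|t]; first exact: XX.
    by rewrite mulr_ge0 ?sqr_ge0 // addr_ge0 // mulr_ge0.
  rewrite -mulr_sumr ler_wpM2l ?sqr_ge0 // big_split /= sumr_const card_ord.
  rewrite (bigD1 s) //= eqxx big1 ?addr0; first by rewrite -[_ *+ N]mulr_natl mulr1n.
  by move=> t /negPf; rewrite eq_sym => ->.
rewrite sumr_const card_ord -[_ *+ N]mulr_natl.
have x1 : N%:R / n%:R <= 1 :> R by rewrite ler_pdivrMr ?ltr0n // mul1r ler_nat.
have x0 : 0 <= N%:R / n%:R :> R by rewrite divr_ge0.
have -> : N%:R * (r ^+ 2 * (N%:R * (3 * err) + 1)) =
    q%:R ^+ 2 * ((N%:R / n%:R) ^+ 2 * (3 * err) + N%:R / n%:R * n%:R^-1).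
  by rewrite /r !exprMn; ring.
rewrite ler_wpM2l ?sqr_ge0 //; apply: lerD.
  by rewrite ler_piMl ?mulr_ge0 // expr_le1.
by rewrite ler_piMl // invr_ge0.
Qed.

Lemma exposure_close k (err : R) v : 0 <= err -> law_close k err -> mature v ->
  E (fun p => `|exposure k v p - s_int k (log_age R n v)|)
    <= Num.sqrt (q%:R ^+ 2 * (3 * err + n%:R^-1)) + q%:R / n%:R.
Proof.
move=> err0 ce mv; have v0 := mature_gt0 mv; have vN : (v <= N)%N by case/andP: mv.
set S := \sum_(v <= t < N) sh k t.+1 / t.+1%:R.
have V0 : 0 < q%:R ^+ 2 * (3 * err + n%:R^-1) :> R.
  have q0 : (0 < q)%N by move: mv; rewrite /mature; case: q => //; rewrite mul0n.
  by rewrite mulr_gt0 ?exprn_gt0 ?ltr0n // ltr_wpDl ?mulr_ge0 // invr_gt0 ltr0n.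
have h1 := prod_expect_le_sqrt attach_ge0 attach_sum1 V0 (exposure_second_moment err0 ce mv).
have h2 := s_int_grid R k (introT andP (conj v0 (vN : (v < n)%N))).
apply: (@le_trans _ _ (E (fun p => `|exposure k v p - S| + q%:R / n%:R))); last first.
  by rewrite prod_expectD (prod_expect_cst attach_sum1) lerD2r.
apply: (le_prod_expect attach_ge0) => p _.
have := ler_normD (exposure k v p - S) (S - s_int k (log_age R n v)).
rewrite addrA subrK => /le_trans; apply; rewrite lerD2l.
exact: le_trans h2 (mature_inv mv).
Qed.

Lemma mature_rate v : mature v ->
  forall t : 'I_N, (v <= t)%:R / t.+1%:R <= q%:R / n%:R :> R.
Proof.
move=> mv t; have [vt|tv] := leqP v t; last by rewrite mul0r divr_ge0.
rewrite mul1r mature_inv //; apply: (mature_le mv); rewrite ltn_ord andbT.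
exact: leq_trans vt _.
Qed.

Lemma s_int_mature k v : mature v -> 0 <= s_int k (log_age R n v) <= q%:R.
Proof.
move=> mv; have v0 := mature_gt0 mv; case/andP: (mv) => nqv vN.
have vn : (0 < v <= n)%N by rewrite v0 leqW.
rewrite s_int_ge0 /=; apply: (le_trans (s_int_le k (log_age_ge0 R vn))).
have x0 : 0 < n%:R / v%:R :> R by rewrite divr_gt0 ?ltr0n.
apply: (le_trans (ltW (ln_sublinear x0))).
by rewrite ler_pdivrMr ?ltr0n // -natrM ler_nat.
Qed.

(** Specialization of [unhit_approx] to one or two mature nodes, for which both
    the rate and the target [S] are at most twice their value for a single node. *)
Let avoid_close k (B : pred 'I_N) (S eta : R) : 0 <= S <= 2 * q%:R ->
  (forall t, hit_rate attach B t <= 2 * (q%:R / n%:R)) ->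
  E (fun p => `|compensator attach (c k) B p - S|) <= 2 * eta ->
  `|E (unhit R (c k) B) - expR (- S)| <=
    expR (2 * q%:R) * (2 * eta) + 4 * q%:R ^+ 2 / n%:R.
Proof.
move=> S0 aB dS.
have Nn : N%:R / n%:R <= 1 :> R by rewrite ler_pdivrMr ?ltr0n // mul1r ler_nat.
have q0 : 0 <= q%:R :> R by [].
have n0 : 0 <= n%:R^-1 :> R by rewrite invr_ge0.
have aK : \sum_t hit_rate attach B t <= 2 * q%:R.
  apply: (@le_trans _ _ (\sum_(t < N) 2 * (q%:R / n%:R))); first exact: ler_sum.
  rewrite sumr_const card_ord -[_ *+ N]mulr_natl.
  have -> : N%:R * (2 * (q%:R / n%:R)) = (2 * q%:R) * (N%:R / n%:R) :> R by ring.
  by rewrite ler_piMr // mulr_ge0.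
apply: (le_trans (unhit_approx attach_ge0 attach_sum1 (@c_pred k) S0 aK)).
apply: lerD; first by rewrite ler_wpM2l ?expR_ge0.
apply: (@le_trans _ _ (\sum_(t < N) (2 * (q%:R / n%:R)) ^+ 2)).
  apply: ler_sum => t _; rewrite lerXn2r ?nnegrE ?hit_rate_ge0 ?mulr_ge0 //.
  exact: attach_ge0.
rewrite sumr_const card_ord -[_ *+ N]mulr_natl.
have -> : N%:R * (2 * (q%:R / n%:R)) ^+ 2 = (4 * q%:R ^+ 2 / n%:R) * (N%:R / n%:R) :> R.
  by rewrite !exprMn; ring.
by rewrite ler_piMr // !mulr_ge0 // exprn_ge0.
Qed.

(** The error at level [k.+1] is the mean deviation of the exposure at level [k],
    for the sets of one and of two nodes. *)
Lemma close_step k (err : R) : 0 <= err -> law_close k err ->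
  law_close k.+1 (expR (2 * q%:R) *
    (2 * (Num.sqrt (q%:R ^+ 2 * (3 * err + n%:R^-1)) + q%:R / n%:R))
    + 4 * q%:R ^+ 2 / n%:R).
Proof.
move=> err0 ce; set eta := Num.sqrt _ + _.
have ex v : mature v -> E (fun p => `|exposure k v p - s_int k (log_age R n v)|) <= eta.
  exact: exposure_close.
have qn0 : 0 <= q%:R / n%:R :> R by rewrite divr_ge0.
have eta0 : 0 <= eta by rewrite addr_ge0 ?sqrtr_ge0.
have shS v : 1 - sh k.+1 v = expR (- s_int k (log_age R n v)).
  by rewrite s_funS subKr.
split=> [v mv|u v mu mv uv].
  rewrite /single_close.
  have -> : E (deepR k.+1 v) - sh k.+1 v =
      - (E (unhit R (c k) (fun j => j == v :> nat)) - expR (- s_int k (log_age R n v))).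
    have -> : E (unhit R (c k) (fun j => j == v :> nat)) = 1 - E (deepR k.+1 v).
      rewrite -[X in X - _](prod_expect_cst attach_sum1 1) -prod_expectB.
      by apply: eq_rrt_expect => p; exact: unhit_deep.
    by rewrite -shS; ring.
  rewrite normrN.
  have /andP[S0 S1] := s_int_mature k mv.
  apply: avoid_close.
  - by rewrite S0 (le_trans S1) // ler_peMl ?ler1n.
  - by move=> t; rewrite hit_rate1 (le_trans (mature_rate mv t)) // ler_peMl ?ler1n.
  - under eq_fun do rewrite compensator1.
    by rewrite (le_trans (ex v mv)) // ler_peMl ?ler1n.
have two (x : R) : 2 * x = x + x by rewrite mulr_natl mulr2n.
have /andP[Su0 Su1] := s_int_mature k mu.
have /andP[Sv0 Sv1] := s_int_mature k mv.
have -> : pair_close k.+1 (expR (2 * q%:R) * (2 * eta) + 4 * q%:R ^+ 2 / n%:R) u v =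
    (`|E (fun p => (1 - deepR k.+1 u p) * (1 - deepR k.+1 v p)) -
       expR (- (s_int k (log_age R n u) + s_int k (log_age R n v)))| <=
     expR (2 * q%:R) * (2 * eta) + 4 * q%:R ^+ 2 / n%:R).
  by rewrite opprD expRD -(shS u) -(shS v).
have -> : E (fun p => (1 - deepR k.+1 u p) * (1 - deepR k.+1 v p)) =
    E (unhit R (c k) (fun j => (j == u :> nat) || (j == v :> nat))).
  by apply: eq_rrt_expect => p pv; rewrite unhit_deep2.
apply: avoid_close.
- by rewrite addr_ge0 //= two lerD.
- by move=> t; rewrite hit_rate2 // two lerD // mature_rate.
- apply: (@le_trans _ _ (E (fun p => `|exposure k u p - s_int k (log_age R n u)| +
    `|exposure k v p - s_int k (log_age R n v)|))).
    apply: (le_prod_expect attach_ge0) => p _; rewrite compensator2 //.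
    by apply: le_trans (ler_normD _ _); rewrite opprD addrACA.
  by rewrite prod_expectD two lerD // ex.
Qed.

End Deep.

(** * The expected fraction of nodes of height at least k *)

Section Limit.
Variable R : realType.
Implicit Types (k q N : nat).

(** The error bound produced by iterating [close_step]. *)
Fixpoint law_err q k N : R :=
  if k is k'.+1 then
    expR (2 * q%:R) *
      (2 * (Num.sqrt (q%:R ^+ 2 * (3 * law_err q k' N + N.+1%:R^-1)) + q%:R / N.+1%:R))
    + 4 * q%:R ^+ 2 / N.+1%:R
  else 0.

Lemma law_err_ge0 q k N : 0 <= law_err q k N.
Proof.
case: k => [|k] /=; first exact: lexx.
apply: addr_ge0; last by rewrite divr_ge0 ?mulr_ge0 ?exprn_ge0.
by rewrite mulr_ge0 ?expR_ge0 // mulr_ge0 // addr_ge0 ?sqrtr_ge0 ?divr_ge0.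
Qed.

Lemma law_close_err q k N : @law_close R N q k (law_err q k N).
Proof.
elim: k => [|k IH]; last by have := close_step (law_err_ge0 q k N) IH.
split => [v _|u v _ _ _]; rewrite /single_close /pair_close /=.
  by rewrite (prod_expect_cst (@attach_sum1 R N)) subrr normr0.
have -> : prod_expect (@attach R N) (fun p => (1 - deepR R 0 u p) * (1 - deepR R 0 v p)) =
    prod_expect (@attach R N) (fun=> 0).
  by apply: eq_bigr => p _; rewrite /deepR /= subrr mul0r.
by rewrite (prod_expect_cst (@attach_sum1 R N)) subrr mul0r subrr normr0.
Qed.

Lemma law_err_cvg0 q k : (law_err q k N @[N --> \oo] --> (0 : R))%classic.
Proof.
have inv0 : (N.+1%:R^-1 @[N --> \oo] --> (0 : R))%classic by exact: cvg_harmonic.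
have cM (c : R) (u : nat -> R) : (u N @[N --> \oo] --> (0 : R))%classic ->
    (c * u N @[N --> \oo] --> (0 : R))%classic.
  by move=> u0; rewrite -(mulr0 c); apply: cvgM => //; exact: cvg_cst.
have cD (u v : nat -> R) : (u N @[N --> \oo] --> (0 : R))%classic ->
    (v N @[N --> \oo] --> (0 : R))%classic ->
    (u N + v N @[N --> \oo] --> (0 : R))%classic.
  by move=> u0 v0; rewrite -(addr0 (0 : R)); exact: cvgD.
elim: k => [|k IH] /=; first exact: cvg_cst.
apply: (cD); last exact: cM.
do 2 apply: (cM); apply: (cD); last exact: cM.
rewrite -(@sqrtr0 R); apply: continuous_cvg; first exact: sqrt_continuous.
by apply: (cM); apply: (cD) => //; exact: cM.
Qed.

Local Notation E N := (prod_expect (@attach R N)).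

Definition deep_frac k N : R :=
  E N (fun p => (\sum_(v < N.+1) deepR R k v p) / N.+1%:R).

Local Notation tail k := (fine (layer_tail R k)).

(** The nodes before [m], the first one that is mature, contribute at most
    [m / n] to the average and just as much to the integral. *)
Lemma deep_frac_approx q k N : (0 < q)%N ->
  `|deep_frac k N - tail k| <= 2 / q%:R + 3 / N.+1%:R + law_err q k N.
Proof.
move=> q0; set n := N.+1.
have n0 : 0 < n%:R :> R by rewrite ltr0n.
pose m := (N %/ q).+1.
have mn : (m <= n)%N by rewrite ltnS leq_div.
have mature_m v : (m <= v < n)%N -> mature N q v.
  move=> /andP[mv vn]; apply/andP; split; last by rewrite -ltnS.
  apply: (@leq_trans (q * m)); last by rewrite leq_mul2l mv orbT.
  by rewrite /m mulnC ltn_ceil.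
have mnq : m%:R / n%:R <= 1 / q%:R + 1 / n%:R :> R.
  rewrite /m -natr1 mulrDl lerD2r ler_pdivrMr // mulrAC ler_pdivlMr ?ltr0n // mul1r.
  by rewrite -natrM ler_nat (leq_trans (leq_trunc_div _ _)).
have m1 : (0 < m <= n)%N by rewrite mn.
have := s_wint_grid R k m1.
have /andP[] := layer_tail_bounds k (log_age_ge0 R m1).
rewrite -{1 2}(fineK (layer_tail_fin_num R k)) !lee_fin expRN_log_age // => t1 t2 g.
have -> : deep_frac k N = (\sum_(0 <= v < m) E N (deepR R k v)) / n%:R +
    (\sum_(m <= v < n) E N (deepR R k v)) / n%:R.
  rewrite -mulrDl -big_cat_nat //= big_mkord /deep_frac mulrC.
  rewrite -prod_expect_sum -prod_expectZ; apply: eq_bigr => p _.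
  by congr (_ * _); rewrite mulrC.
have h1 : 0 <= (\sum_(0 <= v < m) E N (deepR R k v)) / n%:R <= m%:R / n%:R.
  have e01 v : 0 <= E N (deepR R k v) <= 1.
    have cst := prod_expect_cst (@attach_sum1 R N).
    apply/andP; split; [rewrite -[leLHS]cst|rewrite -[leRHS]cst].
      by apply: (le_prod_expect (@attach_ge0 R N)) => p _; case/andP: (deepR01 R k v p).
    by apply: (le_prod_expect (@attach_ge0 R N)) => p _; case/andP: (deepR01 R k v p).
  rewrite divr_ge0 ?ler0n ?sumr_ge0 //=; last by move=> v _; case/andP: (e01 v).
  rewrite ler_pM2r ?invr_gt0 //.
  have -> : m%:R = \sum_(0 <= v < m) 1 :> R by rewrite big_const_nat subn0 iter_addr_0.
  by apply: ler_sum => v _; case/andP: (e01 v).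
have h2 : `|(\sum_(m <= v < n) E N (deepR R k v)) / n%:R -
     (\sum_(m <= r < n) s_fun k (log_age R n r)) / n%:R| <= law_err q k N.
  rewrite -mulrBl -sumrB normrM [`|n%:R^-1|]ger0_norm ?invr_ge0 //.
  rewrite ler_pdivrMr //; apply: (le_trans (ler_norm_sum _ _ _)).
  apply: (@le_trans _ _ (\sum_(m <= v < n) law_err q k N)).
    by apply: ler_sum_nat => v /mature_m mv; have [+ _] := law_close_err q k N; apply.
  rewrite big_const_nat iter_addr_0 -[_ *+ _]mulr_natr ler_wpM2l ?law_err_ge0 //.
  by rewrite ler_nat leq_subr.
move: g h1 h2 t1 t2 mnq; rewrite !div1r.
have -> : 2 / q%:R = q%:R^-1 + q%:R^-1 :> R by ring.
have -> : 3 / n%:R = n%:R^-1 + n%:R^-1 + n%:R^-1 :> R by ring.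
set a := (\sum_(0 <= _ < _) _) / _; set b := (\sum_(_ <= _ < _) E _ _) / _.
set d := (\sum_(_ <= _ < _) s_fun _ _) / _; set x := m%:R / _.
set y := q%:R^-1; set z := n%:R^-1; set e := law_err _ _ _; set w := s_wint _ _.
set t := fine _.
rewrite !ler_norml => /andP[? ?] /andP[? ?] /andP[? ?] ? ? ?; apply/andP; split; lra.
Qed.

Lemma deep_frac_cvg k : (deep_frac k N @[N --> \oo] --> tail k)%classic.
Proof.
apply/cvgrPdist_le => e e0.
(* The fraction [1 / q] of neglected nodes is made small before [N] grows. *)
pose q := (Num.truncn (4 / e)).+1.
have q0 : 0 < q%:R :> R by rewrite ltr0n.
have qe : 2 / q%:R <= e / 2.
  have : 4 / e < q%:R by rewrite truncnS_gt.
  rewrite ltr_pdivrMr // => h; rewrite ler_pdivrMr //; lra.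
have u0 : (3 / N.+1%:R + law_err q k N @[N --> \oo] --> (0 : R))%classic.
  rewrite -(addr0 (0 : R)); apply: cvgD; last exact: law_err_cvg0.
  by rewrite -(mulr0 3); apply: cvgM; [exact: cvg_cst|exact: cvg_harmonic].
have e2 : 0 < e / 2 by rewrite divr_gt0.
move/cvgrPdist_le : u0 => /(_ _ e2).
apply: filterS => N; rewrite sub0r normrN => hN.
rewrite distrC; apply: (le_trans (deep_frac_approx k N (isT : (0 < q)%N))).
rewrite -addrA; apply: (@le_trans _ _ (e / 2 + e / 2)); last by rewrite -splitr.
by apply: lerD => //; apply: le_trans (ler_norm _) hN.
Qed.

End Limit.

(** * The tree built from the choices *)

Section TreeOfChoices.
Variables (N : nat) (p : {ffun 'I_N -> 'I_N}).
Hypothesis p_le : forall t, (p t <= t)%N.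

(** The node [t.+1], which is [lift ord0 t], has parent [p t]. *)
Definition parent (c : 'I_N.+1) : 'I_N.+1 :=
  if unlift ord0 c is Some t then widen_ord (leqnSn N) (p t) else ord0.

Lemma lift_neq0 (t : 'I_N) : lift ord0 t != ord0.
Proof. by rewrite eq_sym neq_lift. Qed.

Lemma parent_lift t : parent (lift ord0 t) = widen_ord (leqnSn N) (p t).
Proof. by rewrite /parent liftK. Qed.

Lemma parent_lt c : c != ord0 -> (parent c < c)%N.
Proof.
case: (unliftP ord0 c) => [t ->|->]; last by rewrite eqxx.
by rewrite parent_lift /= /bump /= add1n ltnS p_le.
Qed.

Lemma rrt_edgeE u v : @rrt_edge N.+1 p u v =
  (u != ord0) && (parent u == v) || (v != ord0) && (parent v == u).
Proof.
have half (x y : 'I_N.+1) :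
    [exists t : 'I_N, (x == t.+1 :> nat) && (y == p t :> nat)] =
    (x != ord0) && (parent x == y).
  case: (unliftP ord0 x) => [t ->|->]; last first.
    by rewrite eqxx; apply/existsP => -[].
  rewrite parent_lift lift_neq0 /= -val_eqE /= eq_sym.
  apply/existsP/idP => [[t' /andP[]]|yt].
    by rewrite /bump /= add1n eqSS => /eqP/val_inj->.
  by exists t; rewrite /bump /= add1n eqxx. 
rewrite -!half; apply/existsP/orP => [[t /orP[h|h]]|[/existsP[t h]|/existsP[t h]]].
- by left; apply/existsP; exists t.
- by right; apply/existsP; exists t.
- by exists t; rewrite h.
- by exists t; rewrite h orbT.
Qed.

Lemma mem_taller k (v : 'I_N.+1) : (v \in taller ord0 parent k) = deep k p v.
Proof.
elim: k v => [|k IH] v; first by rewrite inE.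
apply/imsetP/existsP => [[c /finset.setD1P[c0 ck] ->]|[t /and3P[vt pv dt]]].
  case: (unliftP ord0 c) c0 ck => [t ->|->]; last by rewrite eqxx.
  rewrite IH parent_lift /= /bump /= add1n => _ dt.
  by exists t; apply/and3P; split=> //; exact: p_le.
exists (lift ord0 t); first by rewrite !inE lift_neq0 IH /= /bump /= add1n.
by apply/val_inj; rewrite parent_lift /= (eqP pv).
Qed.

(** A layer is what a round of stripping removes, so its size is a difference of two
    cardinals, each of which is known up to [2 ^ k] or [2 ^ k.+1]. *)
Lemma num_layer_deep (R : realType) k :
  `|(num_layer (n := N.+1) k p)%:R - (\sum_(v < N.+1) deepR R k v p -
     \sum_(v < N.+1) deepR R k.+1 v p)| <= (2 ^ k.+1)%:R.
Proof.
have sumE j : \sum_(v < N.+1) deepR R j v p = #|taller ord0 parent j|%:R.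
  rewrite -sum1_card natr_sum [RHS]big_mkcond /=; apply: eq_bigr => v _.
  by rewrite mem_taller /deepR; case: deep.
pose A j := iter j (strip (@rrt_edge N.+1 p)) [set: 'I_N.+1].
have near j : (#|A j| <= #|taller ord0 parent j| < #|A j| + 2 ^ j)%N.
  have sA := strip_sub_taller parent_lt rrt_edgeE j.
  have cA := card_taller_strip parent_lt rrt_edgeE j.
  rewrite (subset_leq_card sA) /=.
  by rewrite -(cardsID (A j)) (finset.setIidPr sA) ltn_add2l.
have layers : (num_layer (n := N.+1) k p + #|A k.+1| = #|A k|)%N.
  rewrite -(cardsID (leaves (@rrt_edge N.+1 p) (A k)) (A k)).
  by rewrite (finset.setIidPr (leaves_sub _ _)).
rewrite !sumE.
have /andP[lo1 hi1] := near k; have /andP[lo2 hi2] := near k.+1.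
rewrite -layers in lo1 hi1.
move: lo1 hi1 lo2 hi2; rewrite expnS.
set a := num_layer _ _; set b := #|A _|; set x := #|_|; set y := #|_|.
set z := (2 ^ k)%N => h1 h2 h3 h4.
have : (x <= a + y + 2 * z)%N by lia.
have : (a + y <= x + 2 * z)%N by lia.
rewrite -!(ler_nat R) !natrD => f1 f2.
by rewrite ler_norml; apply/andP; split; lra.
Qed.

End TreeOfChoices.

(** * Layer fractions and their limits *)

Section Conclusion.
Variable R : realType.
Local Notation tail k := (fine (layer_tail R k)).

Lemma layer_frac_approx k N :
  `|layer_frac R k N.+1 - (deep_frac R k N - deep_frac R k.+1 N)| <=
    (2 ^ k.+1)%:R / N.+1%:R.
Proof.
set E := prod_expect (@attach R N).
have -> : layer_frac R k N.+1 - (deep_frac R k N - deep_frac R k.+1 N) =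
    E (fun p => N.+1%:R^-1 * ((num_layer (n := N.+1) k p)%:R -
      (\sum_(v < N.+1) deepR R k v p - \sum_(v < N.+1) deepR R k.+1 v p))).
  rewrite /deep_frac -!prod_expectB; apply: eq_bigr => p _; congr (_ * _).
  by rewrite -mulrBl -mulrBl mulrC.
rewrite /E prod_expectZ normrM ger0_norm ?invr_ge0 // mulrC ler_pM2r ?invr_gt0 ?ltr0n //.
apply: (le_trans (ler_norm_prod_expect (@attach_ge0 R N) _)).
rewrite -[leRHS](prod_expect_cst (@attach_sum1 R N)).
apply: (le_prod_expect (@attach_ge0 R N)) => p p_gt0.
apply: num_layer_deep => t; have := p_gt0 t.
by rewrite /attach /attach_prob; case: ifP; rewrite ?ltxx.
Qed.

Lemma layer_frac_cvg k : (layer_frac R k n @[n --> \oo] --> tail k - tail k.+1)%classic.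
Proof.
rewrite -(cvg_shiftS (layer_frac R k)).
have h : ((2 ^ k.+1)%:R / N.+1%:R @[N --> \oo] --> (0 : R))%classic.
  by rewrite -(mulr0 (2 ^ k.+1)%:R); apply: cvgM; [exact: cvg_cst|exact: cvg_harmonic].
have d0 : (layer_frac R k N.+1 - (deep_frac R k N - deep_frac R k.+1 N) @[N --> \oo]
    --> (0 : R))%classic.
  apply/norm_cvg0P; apply: (squeeze_cvgr _ (cvg_cst 0) h).
  by apply: nearW => N /=; rewrite normr_ge0 layer_frac_approx.
have -> : [sequence layer_frac R k N.+1]_N = (fun N =>
    (layer_frac R k N.+1 - (deep_frac R k N - deep_frac R k.+1 N)) +
    (deep_frac R k N - deep_frac R k.+1 N)).
  by apply/funext => N; rewrite subrK.
rewrite -[tail k - _]add0r; apply: (cvgD d0).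
by apply: cvgB; exact: deep_frac_cvg.
Qed.

End Conclusion.

Theorem theorem2 (R : realType) :
  (forall k : nat, cvgn (layer_frac R k)) /\
  (forall k : nat,
     cumulative_layer_dist R k =
     (\int[lebesgue_measure]_(y in `[0%R, +oo[%classic)
        (s_fun k y * expR (- y))%:E)%E).
Proof.
split=> k; first by apply/cvg_ex; eexists; exact: layer_frac_cvg.
have distE j : layer_dist R j = fine (layer_tail R j) - fine (layer_tail R j.+1).
  by apply/cvg_lim => //; exact: layer_frac_cvg.
rewrite -[RHS]/(layer_tail R k) -(fineK (layer_tail_fin_num R k)).
rewrite /cumulative_layer_dist; apply/cvg_lim => //.
have : ((fine (layer_tail R k) - fine (layer_tail R n))%:E @[n --> \oo] -->
    (fine (layer_tail R k))%:E)%classic.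
  apply: cvg_EFin; first exact: nearW.
  have := cvgB (cvg_cst (fine (layer_tail R k))) (@layer_tail_cvg0 R).
  by rewrite subr0; apply.
apply: cvg_trans; apply: near_eq_cvg; near=> n.
have kn : (k <= n)%N by near: n; exact: nbhs_infty_ge.
rewrite /= sumEFin; congr (_%:E).
have := telescope_sumr (fun j => - fine (layer_tail R j)) kn.
rewrite opprK addrC => <-.
by apply: eq_bigr => j _; rewrite distE opprK addrC.
Unshelve. all: by end_near. Qed.
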